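(* Every finite algebra in $CD(4)$ has bounded width. That is: let $\mathcal{B}$ be a finite algebra whose fundamental operations are precisely three ternary operations $p_1,p_2,p_3$ satisfying the identities $$p_i(x,y,x)\approx x\ (i=1,2,3),\quad p_1(x,x,y)\approx x,\quad p_1(x,y,y)\approx p_2(x,y,y),\quad p_2(x,x,y)\approx p_3(x,x,y),\quad p_3(x,y,y)\approx y .$$ Then every relational structure $\mathbf{B}$ (over a finite vocabulary, with the same universe as $\mathcal{B}$) all of whose relations belong to $\operatorname{Inv}(\mathcal{B})$ has bounded width.
   Context: Relational structures have a finite vocabulary (a finite set of relation symbols, each with an arity) and a finite universe; $A$, $B$ denote the universes of $\mathbf{A}$, $\mathbf{B}$. A homomorphism $\mathbf{A}\to\mathbf{B}$ between structures over the same vocabulary is a map $A\to B$ sending each tuple of $R^{\mathbf{A}}$ to a tuple of $R^{\mathbf{B}}$ for every relation symbol $R$; $\mathbf{A}$ is homomorphic to $\mathbf{B}$ if one exists. $\operatorname{Inv}(\mathcal{B})$ is the set of all finitary relations on the universe of $\mathcal{B}$ that are preserved by all operations of $\mathcal{B}$, i.e. all subuniverses of finite powers of $\mathcal{B}$. A partial homomorphism from $\mathbf{A}$ to $\mathbf{B}$ is a mapping from some subset of $A$ to $B$ that preserves all tuples of (relations of) $\mathbf{A}$ entirely contained in its domain. Write $f\subseteq g$ if $\operatorname{dom}(f)\subseteq\operatorname{dom}(g)$ and $f,g$ coincide on $\operatorname{dom}(f)$. For integers $0\le j<k$, a winning $(j,k)$-strategy on $\mathbf{A}$ and $\mathbf{B}$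 is a nonempty set $H$ of partial homomorphisms from $\mathbf{A}$ to $\mathbf{B}$ such that: - (closure under subfunctions) if $g\in H$ and $f\subseteq g$, then $f\in H$; - ($(j,k)$-forth property) if $I\subseteq J\subseteq A$ with $|I|\le j$, $|J|\le k$, and $f\in H$ has domain $I$, then there is $g\in H$ with domain $J$ such that $f\subseteq g$. A structure $\mathbf{B}$ has width $(j,k)$ if for every structure $\mathbf{A}$ over the same vocabulary, the existence of a winning $(j,k)$-strategy on $\mathbf{A}$ and $\mathbf{B}$ implies that $\mathbf{A}$ is homomorphic to $\mathbf{B}$. It has width $j$ if it has width $(j,k)$ for some $k>j$, and bounded width if it has width $j$ for some $j$. An algebra $\mathcal{B}$ has bounded width if every structure $\mathbf{B}$ with relations in $\operatorname{Inv}(\mathcal{B})$ has bounded width. *)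

(* Defs.v *)
From mathcomp Require Import all_boot.

Set Implicit Arguments.
Unset Strict Implicit.
Unset Printing Implicit Defensive.

Record vocabulary := Vocabulary { symbol : finType; arity : symbol -> nat }.

Definition structure (V : vocabulary) (A : finType) :=
  forall R : symbol V, {set (arity R).-tuple A}.

Definition is_hom V (A B : finType) (SA : structure V A) (SB : structure V B)
    (h : A -> B) :=
  forall (R : symbol V) (t : (arity R).-tuple A),
    t \in SA R -> map_tuple h t \in SB R.

Definition homomorphic V (A B : finType)
    (SA : structure V A) (SB : structure V B) :=
  exists h : A -> B, is_hom SA SB h.

(* [f a = None] means that [a] is outside the domain of [f]. *)
Definition pfun (A B : finType) := {ffun A -> option B}.

Definition dom (A B : finType) (f : pfun A B) : {set A} := [set a | isSome (f a)].

Definition subpfun (A B : finType) (f g : pfun A B) :=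
  dom f \subset dom g /\ {in dom f, f =1 g}.

(* The equation on [u] says that the entries of [t] all lie in the domain of
   [f] and that [u] is the image of [t]. *)
Definition is_partial_hom V (A B : finType)
    (SA : structure V A) (SB : structure V B) (f : pfun A B) :=
  forall (R : symbol V) (t : (arity R).-tuple A) (u : (arity R).-tuple B),
    t \in SA R -> map_tuple f t = map_tuple Some u -> u \in SB R.

Record winning_strategy V (A B : finType) (SA : structure V A)
    (SB : structure V B) (j k : nat) (H : {set pfun A B}) : Prop := {
  strategy_neq0 : H != set0;
  strategy_hom : forall f, f \in H -> is_partial_hom SA SB f;
  strategy_sub : forall f g, g \in H -> subpfun f g -> f \in H;
  strategy_forth : forall (I J : {set A}) (f : pfun A B),
    I \subset J -> #|I| <= j -> #|J| <= k -> f \in H -> dom f = I ->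
    exists g, [/\ g \in H, dom g = J & subpfun f g] }.

Definition has_width2 V (B : finType) (SB : structure V B) (j k : nat) :=
  forall (A : finType) (SA : structure V A),
    (exists H, winning_strategy SA SB j k H) -> homomorphic SA SB.

Definition has_width V (B : finType) (SB : structure V B) (j : nat) :=
  exists2 k, j < k & has_width2 SB j k.

Definition bounded_width V (B : finType) (SB : structure V B) :=
  exists j, has_width SB j.

Record algebra (B : finType) := Algebra {
  op_symbol : Type;
  op_arity : op_symbol -> nat;
  op : forall o : op_symbol, (op_arity o).-tuple B -> B }.

(* The arguments are the [rows]; [F] is applied to each column. *)
Definition preserved (B : finType) m (F : m.-tuple B -> B)
    n (R : {set n.-tuple B}) :=
  forall rows : m.-tuple (n.-tuple B),
    (forall i, tnth rows i \in R) ->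
    [tuple F [tuple tnth (tnth rows i) c | i < m] | c < n] \in R.

Definition Inv (B : finType) (alg : algebra B) n (R : {set n.-tuple B}) :=
  forall o : op_symbol alg, preserved (@op B alg o) R.

Definition algebra_bounded_width (B : finType) (alg : algebra B) :=
  forall (V : vocabulary) (SB : structure V B),
    (forall R : symbol V, Inv alg (SB R)) -> bounded_width SB.

Definition ternary_op (B : finType) (p : B -> B -> B -> B) (t : 3.-tuple B) : B :=
  p (tnth t (inord 0)) (tnth t (inord 1)) (tnth t (inord 2)).

Definition algebra_of_three (B : finType) (p1 p2 p3 : B -> B -> B -> B) :
    algebra B :=
  @Algebra B 'I_3 (fun=> 3)
    (fun o => ternary_op (tnth [tuple p1; p2; p3] o)).

(* Main.v *)
Require Import Defs.
From mathcomp Require Import all_boot.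

Set Implicit Arguments.
Unset Strict Implicit.
Unset Printing Implicit Defensive.

(** Bounded width is obtained from an absorption argument in the style of
    Barto and Kozik, valid for Jonsson chains of any length.

    Let r be larger than every arity.  A winning (2r, 3r)-strategy H turns the
    question into a binary constraint network: the variables are the r-tuples s
    of elements of A, the values are the r-tuples of elements of B, and the
    constraint between s and t is the compatible relation [generated s t]
    generated by the pairs (f s, f t) with f in H.  The constraints remember the
    relations of B and the equalities between entries of tuples, so a global
    solution of the network is a homomorphism ([strategy_homomorphic]).  The
    forth property makes the network path consistent: a constraint between two
    variables is implied by the constraints along any path joining them.

    Path consistency does not survive when domains are shrunk, so a weaker
    invariant is carried along, [prague]: the network is arc consistent and,
    whenever variables are visited periodically v 0, v 1, ..., every pair allowed
    between v i and v j is realised by a walk through the domains that starts at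
    time i and ends at a time congruent to j.  Two facts then give a solution.

    - The invariant passes to every arc consistent family of nonempty
      subdomains C that absorb, meaning that p i maps C x P x C into C for
      every i ([prague_absorb]).  Applying p i to two closed walks in C and one
      walk in P gives a walk in C; by the Jonsson identities, two points of C
      that lie on closed C-walks of the same length and are mutually accessible in P are also
      accessible in C ([connect_loops]).

    - If some domain is not a singleton, such a family that is strictly smaller
      exists ([prague_reduction]).  Since p i x y x = x, singletons absorb.
      Propagating a proper absorbing set along constraints and keeping a
      strongly connected component with no exit, at most one set sits at each
      variable ([link_sub]: this is where the invariant is used), and these
      sets, completed by full domains elsewhere, are arc consistent.

    Iterating, all domains become singletons, and arc consistency says that
    these form a solution ([prague_solution]). *)

(** * Accessibility in finite graphs *)

(** A vertex accessible from x with the fewest accessible vertices. *)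
Lemma connect_terminal (T : finType) (e : rel T) x :
  exists2 y, connect e x y & forall z, connect e y z -> connect e z y.
Proof.
have [y xy min_y] :=
  @arg_minnP T x (connect e x) (fun y => #|connect e y|) (connect0 e x).
exists y => // z yz.
have sub_zy : connect e z \subset connect e y.
  by apply/subsetP=> w; apply: connect_trans yz.
have eq_zy : #|connect e z| = #|connect e y|.
  by apply/eqP; rewrite eqn_leq subset_leq_card // min_y // (connect_trans xy).
have -> : connect e z y = connect e y y := subset_cardP eq_zy sub_zy y.
exact: connect0.
Qed.

Lemma connect_homo (T T' : finType) (e : rel T) (e' : rel T') (f : T -> T') :
  (forall x y, e x y -> connect e' (f x) (f y)) ->
  forall x y, connect e x y -> connect e' (f x) (f y).
Proof.
move=> ef x _ /connectP[s + ->]; elim: s x => [|y s IHs] x /=; first by rewrite connect0.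
by case/andP=> /ef xy /IHs; apply: connect_trans.
Qed.

(** The identities of a Jonsson chain enter only through the fact that a and b
    are connected in this graph, which makes the argument independent of the
    length of the chain. *)
Definition jonsson_edge (D I : finType) (p : I -> D -> D -> D -> D) (a b : D)
    : rel D :=
  fun u w => [exists i, ((u == p i a a b) && (w == p i a b b))
                     || ((w == p i a a b) && (u == p i a b b))].

(** * Networks of binary constraints and walks *)
Section Instance.

Variables (X D I : finType) (p : I -> D -> D -> D -> D) (R : X -> X -> rel D).
Hypothesis p_xyx : forall i x y, p i x y x = x.
Hypothesis p_jonsson : forall a b, connect (jonsson_edge p a b) a b.
Hypothesis R_sym : forall x y a b, R x y a b -> R y x b a.
Hypothesis R_op : forall i x y a b c a' b' c',
  R x y a a' -> R x y b b' -> R x y c c' -> R x y (p i a b c) (p i a' b' c').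

Implicit Types (P C : X -> {set D}) (v : nat -> X).

(** Time k of a walk is spent at the variable v k. *)
Definition step P v k : rel D :=
  fun a b => [&& a \in P (v k), b \in P (v k.+1) & R (v k) (v k.+1) a b].

Fixpoint walk P v s m : rel D :=
  if m is m'.+1 then fun a b => [exists c, step P v s a c && walk P v s.+1 m' c b]
  else fun a b => (a \in P (v s)) && (a == b).

Definition periodic n v := forall k, v (k + n) = v k.

Definition arc_consistent P :=
  forall x y a, a \in P x -> exists2 b, b \in P y & R x y a b.

(** The field [prague_walk] is the condition defining Prague strategies, with
    walks that may start anywhere on the closed path v.  The case v i = v j of
    diagonal pairs lets a walk come back to a value at any other time when its
    variable recurs; the case of consecutive times, through the symmetry of R,
    says that every step can be undone. *)
Record prague P : Prop := {
  prague_ex : forall x, exists a, a \in P x;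
  prague_op : forall i x a b c,
    a \in P x -> b \in P x -> c \in P x -> p i a b c \in P x;
  prague_refl : forall x a, a \in P x -> R x x a a;
  prague_arc : arc_consistent P;
  prague_walk : forall n v i j a b, 0 < n -> periodic n v ->
    a \in P (v i) -> b \in P (v j) -> R (v i) (v j) a b ->
    exists2 m, i + m = j %[mod n] & walk P v i m a b }.

(** Absorption in the sense of Jonsson ideals. *)
Definition absorbs (C P : {set D}) :=
  C \subset P /\
  forall i a b c, a \in C -> b \in P -> c \in C -> p i a b c \in C.

Lemma walk_start P v s m a b : walk P v s m a b -> a \in P (v s).
Proof. by case: m => [|m] /= => [/andP[]|/existsP[c /andP[/and3P[]]]]. Qed.

Lemma walk_end P v s m a b : walk P v s m a b -> b \in P (v (s + m)).
Proof.
elim: m s a => [|m IHm] s a /=; first by rewrite addn0 => /andP[aP /eqP <-].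
by case/existsP=> c /andP[_ /IHm]; rewrite addSnnS.
Qed.

Lemma walk_cat P v s m m' a b c :
  walk P v s m a b -> walk P v (s + m) m' b c -> walk P v s (m + m') a c.
Proof.
elim: m s a => [|m IHm] s a /=; first by rewrite addn0 => /andP[_ /eqP ->].
case/existsP=> d /andP[ad db] bc; apply/existsP; exists d; rewrite ad /=.
by apply: IHm db _; rewrite addSnnS.
Qed.

Lemma periodic_modn n v i j : periodic n v -> i = j %[mod n] -> v i = v j.
Proof.
move=> pv ij; have pvm q k : v (q * n + k) = v k.
  by elim: q => // q IHq; rewrite mulSnr addnAC pv.
by rewrite (divn_eq i n) (divn_eq j n) !pvm ij.
Qed.

Lemma periodic_mul n v k : periodic n v -> periodic (n * k) v.
Proof.
by move=> pv s; apply: periodic_modn pv _; rewrite -modnDmr modnMr addn0.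
Qed.

Lemma walk_modn P n v i j m a b : periodic n v -> i = j %[mod n] ->
  walk P v i m a b = walk P v j m a b.
Proof.
move=> pv; elim: m i j a => [|m IHm] i j a ij /=.
  by rewrite (periodic_modn pv ij).
have ijS : i.+1 = j.+1 %[mod n] by rewrite -addn1 -modnDml ij modnDml addn1.
apply: eq_existsb => c; congr (_ && _); last exact: IHm.
by rewrite /step (periodic_modn pv ij) (periodic_modn pv ijS).
Qed.

Lemma walk_sub C P v s m a b : (forall x, C x \subset P x) ->
  walk C v s m a b -> walk P v s m a b.
Proof.
move=> CP; elim: m s a => [|m IHm] s a /=.
  by case/andP=> aC ->; rewrite (subsetP (CP _)).
case/existsP=> c /andP[/and3P[aC cC ac] /IHm cb]; apply/existsP; exists c.
by rewrite /step !(subsetP (CP _)) // ac.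
Qed.

Lemma walk_op C P v s m i a a' b b' c c' : (forall x, absorbs (C x) (P x)) ->
  walk C v s m a a' -> walk P v s m b b' -> walk C v s m c c' ->
  walk C v s m (p i a b c) (p i a' b' c').
Proof.
move=> CP; elim: m s a b c => [|m IHm] s a b c /=.
  move=> /andP[aC /eqP <-] /andP[bP /eqP <-] /andP[cC /eqP <-].
  by rewrite eqxx andbT; apply: (CP _).2.
move=> /existsP[d /andP[/and3P[aC dC ad] da]].
move=> /existsP[e /andP[/and3P[bP eP be] eb]].
move=> /existsP[f /andP[/and3P[cC fC cf] fc]].
apply/existsP; exists (p i d e f); rewrite (IHm s.+1 d e f) // andbT.
by rewrite /step (CP _).2 // (CP _).2 // R_op.
Qed.

Lemma walk_forward C v s m a : arc_consistent C -> a \in C (v s) ->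
  exists b, walk C v s m a b.
Proof.
move=> acC; elim: m s a => [|m IHm] s a aC; first by exists a; rewrite /= aC eqxx.
have [c cC ac] := acC _ (v s.+1) _ aC; have [b cb] := IHm _ _ cC.
by exists b; apply/existsP; exists c; rewrite /step aC cC ac.
Qed.

Lemma walk_backward C v s m b : arc_consistent C -> b \in C (v (s + m)) ->
  exists a, walk C v s m a b.
Proof.
move=> acC; elim: m s => [|m IHm] s bC.
  by exists b; rewrite /= -{1}(addn0 s) bC eqxx.
have [|c cb] := IHm s.+1; first by rewrite addSnnS.
have cC := walk_start cb; have [a aC ca] := acC _ (v s) _ cC.
by exists a; apply/existsP; exists c; rewrite /step aC cC R_sym.
Qed.

(** * Closed walks and absorption *)
Lemma connect_walk P n v s a b : periodic n v -> a \in P (v s) ->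
  connect (walk P v s n) a b -> exists k, walk P v s (n * k) a b.
Proof.
move=> pv + /connectP[q + ->]; elim: q a => [|c q IHq] a aP /=.
  by move=> _; exists 0; rewrite muln0 /= aP eqxx.
case/andP=> ac cq.
have sn : s + n = s %[mod n] by rewrite modnDr.
have cP : c \in P (v s) by rewrite -(periodic_modn pv sn) (walk_end ac).
have [k ck] := IHq c cP cq.
by exists k.+1; rewrite mulnS; apply: walk_cat ac _; rewrite (walk_modn _ _ _ _ pv sn).
Qed.

Lemma walk_split P v s m m' a c :
  walk P v s (m + m') a c -> exists2 b, walk P v s m a b & walk P v (s + m) m' b c.
Proof.
elim: m s a => [|m IHm] s a.
  by move=> ac; exists a; rewrite ?addn0 //= eqxx (walk_start ac).
case/existsP=> d /andP[ad /IHm[b db bc]].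
by exists b; [apply/existsP; exists d; rewrite ad | rewrite -addSnnS].
Qed.

Lemma walk_connect P n v s k a b : periodic n v ->
  walk P v s (n * k) a b -> connect (walk P v s n) a b.
Proof.
move=> pv; elim: k a => [|k IHk] a.
  by rewrite muln0 /= => /andP[_ /eqP ->]; apply: connect0.
rewrite mulnS => /walk_split[c ac cb]; apply: connect_trans (connect1 ac) (IHk _ _).
by rewrite -(@walk_modn P n v (s + n) s _ _ _ pv) // modnDr.
Qed.

Section Reachability.

Variables (P : X -> {set D}) (n : nat) (v : nat -> X).
Hypotheses (pragueP : prague P) (n_gt0 : 0 < n) (pv : periodic n v).

(** Each step is undone by [prague_walk] and the symmetry of R. *)
Lemma walk_return s m a b : walk P v s m a b ->
  exists2 m', n %| m + m' & walk P v (s + m) m' b a.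
Proof.
elim: m s a => [|m IHm] s a /=.
  by case/andP=> aP /eqP <-; exists 0; rewrite ?dvdn0 //= addn0 aP eqxx.
case/existsP=> c /andP[/and3P[aP cP ac] /IHm[m1 n_m1 bc]].
have [m2 ca_mod ca] := prague_walk pragueP n_gt0 pv cP aP (R_sym ac).
have n_m2 : n %| m2.+1.
  by move/eqP: ca_mod; rewrite -{2}(addn0 s) addSnnS eqn_modDl mod0n.
have m_sum : m.+1 + (m1 + m2) = m + m1 + m2.+1 by rewrite addSn addnS addnA.
exists (m1 + m2); first by rewrite m_sum dvdn_add.
rewrite -addSnnS; apply: walk_cat bc _.
rewrite (@walk_modn P n v _ s.+1 _ _ _ pv) //.
by rewrite -addnA -modnDmr (eqP n_m1) addn0.
Qed.

(** The period n can be replaced by a multiple N: v is also N-periodic, and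
    [prague_walk] with period N, applied to the pair (b, b), gives a walk from b
    to b that corrects the length modulo N. *)
Lemma connect_align N s m a b : 0 < N -> periodic N v -> n %| m ->
  walk P v s m a b -> connect (walk P v s N) a b.
Proof.
move=> N_gt0 pvN n_m ab; have bP := walk_end ab.
have vE : v (s + m) = v s.
  by apply: (periodic_modn pv); rewrite -modnDmr (eqP n_m) addn0.
have bP' : b \in P (v s) by rewrite -vE.
have bb : R (v (s + m)) (v s) b b by rewrite vE (prague_refl pragueP).
have [k k_mod bk] := prague_walk pragueP N_gt0 pvN bP bP' bb.
have /dvdnP[q mkE] : N %| m + k.
  by move/eqP: k_mod; rewrite -{2}(addn0 s) -addnA eqn_modDl mod0n.
by apply: (@walk_connect _ _ _ _ q); rewrite // mulnC -mkE (walk_cat ab bk).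
Qed.

Lemma connect_return s a b : a \in P (v s) ->
  connect (walk P v s n) a b -> connect (walk P v s n) b a.
Proof.
move=> aP /(connect_walk pv aP)[k ab]; have [m n_m ba] := walk_return ab.
apply: (connect_align (m := m)) => //; first by move: n_m; rewrite dvdn_addr ?dvdn_mulr.
rewrite -(@walk_modn P n v (s + n * k) s) //.
by rewrite -modnDmr modnMr addn0.
Qed.

Section Absorption.

Variable C : X -> {set D}.
Hypotheses (CP : forall x, absorbs (C x) (P x)) (acC : arc_consistent C).

(** Fix a and b in the outer arguments of p i, using their closed walks in C,
    and move the middle argument along a walk in P: absorption keeps the result
    in C.  This joins p i a a b and p i a b b in both directions, hence a to b
    along the Jonsson chain. *)
Lemma connect_loops N s a b :
    walk C v s N a a -> walk C v s N b b ->
    connect (walk P v s N) a b -> connect (walk P v s N) b a ->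
  connect (walk C v s N) a b.
Proof.
move=> aa bb ab ba.
have move_mid i u w : connect (walk P v s N) u w ->
    connect (walk C v s N) (p i a u b) (p i a w b).
  apply: (@connect_homo _ _ _ _ (fun c => p i a c b)) => {}u {}w uw.
  by apply: connect1; apply: walk_op CP _ _ _.
apply: (@connect_homo _ _ _ _ id) (p_jonsson a b) => u w /existsP[i].
by case/orP=> /andP[/eqP -> /eqP ->]; apply: move_mid.
Qed.

(** By arc consistency a walk in C can be prolonged forever, and it ends up in
    a component without exit, whose points lie on closed walks. *)
Lemma loop_after s a : a \in C (v s) ->
  exists c, connect (walk C v s n) a c /\ exists2 l, 0 < l & walk C v s (n * l) c c.
Proof.
move=> aC; have [c ac c_term] := connect_terminal (walk C v s n) a.
have sn k : s + n * k = s %[mod n] by rewrite -modnDmr modnMr addn0.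
exists c; split=> //.
have cC : c \in C (v s).
  have [k ak] := connect_walk pv aC ac.
  by rewrite -(periodic_modn pv (sn k)) (walk_end ak).
have [d cd] := walk_forward n acC cC.
have dC : d \in C (v s).
  by rewrite -(periodic_modn pv (sn 1)) muln1 (walk_end cd).
have [k dc] := connect_walk pv dC (c_term _ (connect1 cd)).
exists k.+1 => //; rewrite mulnS; apply: walk_cat cd _.
by rewrite (walk_modn C _ _ _ pv (_ : _ = s %[mod n])) // modnDr.
Qed.

Lemma loop_before s a : a \in C (v s) ->
  exists c, connect (walk C v s n) c a /\ exists2 l, 0 < l & walk C v s (n * l) c c.
Proof.
move=> aC; pose e := walk C v s n.
have eV x y : connect (fun x => e^~ x) x y = connect e y x.
  exact: (connect_rev e x y).
have [c] := connect_terminal (fun x => e^~ x) a; rewrite eV => ca c_term.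
have vsn : v (s + n) = v s by rewrite pv.
exists c; split=> //.
have cC : c \in C (v s).
  case/connectP: ca => [[|d q] /=]; first by move=> _ <-.
  by case/andP=> /walk_start.
have [|d dc] := walk_backward (m := n) acC (_ : c \in C (v (s + n))).
  by rewrite vsn.
have dC := walk_start dc.
have := c_term d; rewrite !eV => /(_ (connect1 dc)) cd.
have [k ck] := connect_walk pv cC cd.
exists k.+1 => //; rewrite mulnSr; apply: walk_cat ck _.
by rewrite (walk_modn C _ _ _ pv (_ : _ = s %[mod n])) // -modnDmr modnMr addn0.
Qed.

(** The points a and b need not be known to lie on closed walks in C, but some c
    accessible from a in C does, and so does some d from which b is accessible.
    These are mutually accessible in P, so c leads to d in C. *)
Lemma connect_absorb s a b : a \in C (v s) -> b \in C (v s) ->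
  connect (walk P v s n) a b -> connect (walk C v s n) a b.
Proof.
move=> aC bC ab.
have [c [ac [l l_gt0 cc]]] := loop_after aC.
have [d [db [l' l'_gt0 dd]]] := loop_before bC.
have CsubP x : C x \subset P x := (CP x).1.
have connectCP x y : connect (walk C v s n) x y -> connect (walk P v s n) x y.
  by apply: (@connect_homo _ _ _ _ id) => u w /(walk_sub CsubP)/connect1.
have aP := subsetP (CsubP _) _ aC; have cP := walk_start (walk_sub CsubP cc).
have dP := walk_start (walk_sub CsubP dd).
have cd : connect (walk P v s n) c d.
  apply: connect_trans (connect_return aP (connectCP _ _ ac)) _.
  by apply: connect_trans ab (connect_return dP (connectCP _ _ db)).
(* A common length for the closed walks at c and at d. *)
pose N := n * (l * l').
have N_gt0 : 0 < N by rewrite !muln_gt0 n_gt0 l_gt0.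
have pvN : periodic N v by apply: periodic_mul.
have align x y : x \in P (v s) ->
    connect (walk P v s n) x y -> connect (walk P v s N) x y.
  move=> xP /(connect_walk pv xP)[k xy].
  by apply: (connect_align N_gt0 pvN _ xy); rewrite dvdn_mulr.
have loopN q x k : walk C v s (n * q) x x -> walk C v s (n * (q * k)) x x.
  move=> xx; elim: k => [|k IHk]; first by rewrite !muln0 /= (walk_start xx) eqxx.
  rewrite mulnS mulnDr; apply: walk_cat xx _.
  by rewrite (walk_modn C _ _ _ pv (_ : _ = s %[mod n])) // -modnDmr modnMr addn0.
have ccN := loopN _ _ l' cc; have ddN := loopN _ _ l dd.
rewrite [l' * l]mulnC in ddN.
have /(connect_walk pvN (walk_start cc))[k ck] :=
  connect_loops ccN ddN (align _ _ cP cd) (align _ _ dP (connect_return cP cd)).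
apply: connect_trans ac (connect_trans _ db).
by apply: (walk_connect (k := l * l' * k) pv); rewrite mulnA.
Qed.

End Absorption.
End Reachability.

Lemma prague_absorb P C : prague P -> (forall x, absorbs (C x) (P x)) ->
  (forall x, exists a, a \in C x) -> arc_consistent C -> prague C.
Proof.
move=> pragueP CP exC acC; have CsubP x : C x \subset P x := (CP x).1.
split=> // [i x a b c aC bC cC | x a aC | n v i j a b n_gt0 pv aC bC ab].
- by apply: (CP x).2; rewrite // (subsetP (CsubP x)).
- by apply: (prague_refl pragueP); rewrite (subsetP (CsubP x)).
have [m ijm abm] := prague_walk pragueP n_gt0 pv (subsetP (CsubP _) _ aC)
                                (subsetP (CsubP _) _ bC) ab.
have bC' : b \in C (v (i + m)) by rewrite (periodic_modn pv ijm).
(* Move the end point b back to time i inside C, so that both end points sit at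
   the same time and [connect_absorb] applies. *)
have [b' b'b] := walk_backward acC bC'.
have [m' n_mm' bb'] := walk_return pragueP n_gt0 pv (walk_sub CsubP b'b).
have ab' : connect (walk P v i n) a b'.
  exact: (connect_align pragueP pv n_gt0 pv n_mm' (walk_cat abm bb')).
have [k ab'k] := connect_walk pv aC
  (connect_absorb pragueP n_gt0 pv CP acC aC (walk_start b'b) ab').
have ik : i + n * k = i %[mod n] by rewrite -modnDmr modnMr addn0.
exists (n * k + m); first by rewrite addnA -modnDml ik modnDml.
by apply: walk_cat ab'k _; rewrite (walk_modn C _ _ _ pv ik).
Qed.

(** * Shrinking the domains *)
Definition neighbours P x y (A : {set D}) : {set D} :=
  [set b in P y | [exists a in A, R x y a b]].

(** Propagation of a set of values along one constraint, as long as the result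
    is a proper subset of the domain. *)
Definition link P : rel (X * {set D}) := fun s t =>
  (t.2 == neighbours P s.1 t.1 s.2) && (t.2 != P t.1).

Lemma link_ideal P s t : prague P -> absorbs s.2 (P s.1) /\ (exists a, a \in s.2) ->
  connect (link P) s t -> absorbs t.2 (P t.1) /\ (exists a, a \in t.2).
Proof.
move=> pragueP + /connectP[q + ->]; elim: q s => [|[y B] q IHq] [x A] //=.
move=> [[AP absA] [a aA]] /andP[/andP[/= /eqP -> _]] /IHq; apply; split=> /=; last first.
  have [b bP ab] := prague_arc pragueP y (subsetP AP _ aA).
  by exists b; rewrite !inE bP; apply/existsP; exists a; rewrite aA.
split=> [|i b c d]; first by apply/subsetP=> b; rewrite inE => /andP[].
rewrite !inE => /andP[bP /existsP[b' /andP[b'A bb]]] cP.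
case/andP=> dP /existsP[d' /andP[d'A dd]].
have [c' c'P cc] := prague_arc pragueP x cP.
rewrite (prague_op pragueP) //; apply/existsP; exists (p i b' c' d').
by rewrite absA // R_op // R_sym.
Qed.

Lemma link_proper P s t : s.2 != P s.1 -> connect (link P) s t -> t.2 != P t.1.
Proof.
move=> + /connectP[q + ->]; elim: q s => [|t' q IHq] //= s _ /andP[/andP[_ t'P]].
exact: IHq.
Qed.

(** A closed path of links through (x, A) and (x, B) gives a periodic sequence of
    variables together with sets that no walk can leave.  By [prague_walk] for the
    diagonal pair (a, a), a walk leads from a at a time carrying A to a at a time
    carrying B. *)
Lemma link_sub P x (A B : {set D}) : prague P -> A \subset P x ->
  connect (link P) (x, A) (x, B) -> connect (link P) (x, B) (x, A) -> A \subset B.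
Proof.
move=> pragueP AP /connectP[q Aq Bq] /connectP[q' Bq' Aq'].
have [q'0|q'_gt0] := posnP (size q').
  by move/size0nil: q'0 Aq' => -> [->].
pose c := q ++ q'; pose n := size c.
have n_gt0 : 0 < n by rewrite /n size_cat addn_gt0 q'_gt0 orbT.
have pathc : path (link P) (x, A) c by rewrite cat_path Aq -Bq.
have lastc : last (x, A) c = (x, A) by rewrite last_cat -Bq.
pose u k := nth (x, A) ((x, A) :: c) (k %% n).
have uS k : link P (u k) (u k.+1).
  have lt_kn : k %% n < n by rewrite ltn_mod.
  suff -> : u k.+1 = nth (x, A) c (k %% n) by move/pathP: pathc; apply.
  rewrite /u -addn1 -modnDml addn1.
  move: lt_kn; rewrite leq_eqVlt => /predU1P[kn|lt_kn]; last by rewrite modn_small.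
  by rewrite -[RHS]/(nth (x, A) ((x, A) :: c) (k %% n).+1) kn modnn -last_nth lastc.
pose v k := (u k).1.
have pv : periodic n v by move=> k; rewrite /v /u modnDr.
have u_walk k m a b : a \in (u k).2 -> walk P v k m a b -> b \in (u (k + m)).2.
  elim: m k a => [|m IHm] k a ak /=; first by rewrite addn0 => /andP[_ /eqP <-].
  case/existsP=> d /andP[/and3P[aP dP ad]]; rewrite -addSnnS; apply: IHm.
  case/andP: (uS k) => /eqP -> _; rewrite !inE dP; apply/existsP; exists a.
  by rewrite ak.
have u0 : u 0 = (x, A) by rewrite /u mod0n.
have uq : u (size q) = (x, B).
  have lt_qn : size q < n by rewrite /n size_cat -addn1 leq_add2l.
  rewrite /u modn_small // Bq (last_nth (x, A)) -cat_cons nth_cat /= ltnSn //.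
apply/subsetP=> a aA; have aP := subsetP AP a aA.
have v0 : v 0 = x by rewrite /v u0.
have vq : v (size q) = x by rewrite /v uq.
have [||| m mq am] :=
  prague_walk pragueP (i := 0) (j := size q) (a := a) (b := a) n_gt0 pv.
- by rewrite v0.
- by rewrite vq.
- by rewrite v0 vq (prague_refl pragueP).
have := u_walk _ _ _ _ _ am; rewrite u0 => /(_ aA).
by rewrite /u mq -/(u (size q)) uq.
Qed.

(** Inside a component without exit, propagating a set C z to z' gives either the
    whole domain of z' or the set chosen there.  Read through the symmetry of R,
    both cases provide a neighbour in C z to each element of C z', which is arc
    consistency. *)
Lemma prague_reduction P x : prague P -> #|P x| != 1 ->
  exists C, [/\ forall y, absorbs (C y) (P y), forall y, exists a, a \in C y,
                arc_consistent C & exists y, C y != P y].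
Proof.
move=> pragueP Px1; have [b bP] := prague_ex pragueP x.
have b_proper : [set b] != P x.
  by apply: contraNneq Px1 => <-; rewrite cards1.
have b_ideal : absorbs [set b] (P x) /\ exists a, a \in [set b].
  split; last by exists b; rewrite set11.
  by split=> [|i c d e /set1P-> _ /set1P->]; rewrite ?sub1set // p_xyx set11.
have [[y B] xy term] := connect_terminal (link P) (x, [set b]).
pose scc z A := connect (link P) (y, B) (z, A).
have sccP z A : scc z A -> (absorbs A (P z) /\ exists a, a \in A) /\ A != P z.
  move=> yz; have xz := connect_trans xy yz.
  split; first exact: (@link_ideal P (x, [set b]) (z, A) pragueP b_ideal xz).
  exact: (@link_proper P (x, [set b]) (z, A) b_proper xz).
have scc_uniq z A A' : scc z A -> scc z A' -> A = A'.
  move=> zA zA'.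
  have [[AP _] _] := (sccP _ _ zA).1; have [[A'P _] _] := (sccP _ _ zA').1.
  have AA' := connect_trans (term _ zA) zA'; have A'A := connect_trans (term _ zA') zA.
  apply/eqP; rewrite eqEsubset; apply/andP.
  by split; [apply: link_sub AA' A'A | apply: link_sub A'A AA'].
pose C z := odflt (P z) [pick A | scc z A].
have CE z A : scc z A -> C z = A.
  by rewrite /C; case: pickP => [A' zA' /(scc_uniq _ _ _ zA') | ->].
have C_case z : scc z (C z) \/ C z = P z.
  by rewrite /C; case: pickP => [A zA | _]; [left | right].
have CP z : absorbs (C z) (P z).
  case: (C_case z) => [/sccP[[]] // | ->]; split=> // i a c d aP cP dP.
  exact: (prague_op pragueP).
have C_scc z z' : scc z (C z) ->
    neighbours P z z' (C z) = P z' \/ neighbours P z z' (C z) = C z'.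
  move=> zC; have [|proper] := eqVneq (neighbours P z z' (C z)) (P z'); first by left.
  right; apply/esym/CE; apply: connect_trans zC (connect1 _).
  by rewrite /link /= eqxx.
exists C; split=> // [z | z z' a aC | ].
- by case: (C_case z) => [/sccP[[]] // | ->]; apply: (prague_ex pragueP).
- have aP := subsetP (CP z).1 a aC.
  case: (C_case z') => [z'C | ->]; last exact: (prague_arc pragueP).
  have: a \in neighbours P z' z (C z') by case: (C_scc z' z z'C) => ->.
  by rewrite inE => /andP[_ /existsP[c /andP[cC ca]]]; exists c; rewrite // R_sym.
exists y; rewrite (CE y B) ?connect0 //; last exact: connect0.
by case: (sccP y B (connect0 _ _)).
Qed.

(** Induction on the total size of the domains. *)
Lemma prague_solution P : prague P ->
  exists h : X -> D, forall x y, R x y (h x) (h y) /\ h x \in P x.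
Proof.
have [m] := ubnP (\sum_x #|P x|); elim: m P => // m IHm P /ltnSE-le_Pm pragueP.
case: (pickP (fun x => #|P x| != 1)) => [x Px1 | P1]; last first.
  have [h hP] := fin_all_exists (prague_ex pragueP).
  exists h => x y; split=> //; have [b bP hb] := prague_arc pragueP y (hP x).
  have /cards1P[c Pc] : #|P y| == 1 by rewrite -[_ == _]negbK P1.
  by move: (hP y) bP; rewrite Pc => /set1P-> /set1P<-.
have [C [CP exC acC [y Cy]]] := prague_reduction pragueP Px1.
have [|h hC] := IHm C _ (prague_absorb pragueP CP exC acC).
  apply: leq_trans le_Pm; rewrite (bigD1 y) //= [X in _ < X](bigD1 y) //= -addSn.
  apply: leq_add; first by apply: proper_card; rewrite properEneq Cy (CP y).1.
  by apply: leq_sum => z _; apply: subset_leq_card (CP z).1.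
exists h => z z'; have [hR hz] := hC z z'.
by split=> //; apply: subsetP (CP z).1 _ hz.
Qed.

End Instance.

(** * The network of a winning strategy *)
Section StrategyInstance.

Variables (V : vocabulary) (A B I : finType).
Variables (SA : structure V A) (SB : structure V B).
Variable (p : I -> B -> B -> B -> B).
Hypothesis p_xyx : forall i x y, p i x y x = x.
Hypothesis p_SB : forall i (T : symbol V) x y z,
  x \in SB T -> y \in SB T -> z \in SB T ->
  [tuple p i (tnth x c) (tnth y c) (tnth z c) | c < arity T] \in SB T.

Variables (r : nat) (H : {set pfun A B}).
Hypothesis r_gt0 : 0 < r.
Hypothesis H_win : winning_strategy SA SB (2 * r) (3 * r) H.

Local Notation X := {ffun 'I_r -> A}.
Local Notation D := {ffun 'I_r -> B}.

Definition pointwise i (a b c : D) : D := [ffun k => p i (a k) (b k) (c k)].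

(** Assumed on tuples, since connectedness in a power is not a consequence of
    connectedness in the graphs over B. *)
Hypothesis pointwise_jonsson : forall a b : D,
  connect (jonsson_edge pointwise a b) a b.

Definition agree (f : pfun A B) (s : X) (a : D) := [forall k, f (s k) == Some (a k)].

Definition strategy_rel (s t : X) : {set D * D} :=
  [set ab | [exists f in H, agree f s ab.1 && agree f t ab.2]].

Definition op_closed (S : {set D * D}) :=
  [forall i, forall x in S, forall y in S, forall z in S,
    (pointwise i x.1 y.1 z.1, pointwise i x.2 y.2 z.2) \in S].

(** A winning strategy need not be closed under the operations, whereas the
    absorption argument needs compatible constraints; hence the closure. *)
Definition generated (s t : X) : rel D := fun a b =>
  [forall S : {set D * D},
     op_closed S && (strategy_rel s t \subset S) ==> ((a, b) \in S)].

Lemma op_closedP (Q : rel D) :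
  (forall i a b c a' b' c', Q a a' -> Q b b' -> Q c c' ->
    Q (pointwise i a b c) (pointwise i a' b' c')) ->
  op_closed [set ab | Q ab.1 ab.2].
Proof.
move=> QP; apply/'forall_forall_inP => i [x x'] xQ.
apply/'forall_in_forall_inP => - [y y'] yQ [z z'] zQ.
by rewrite !inE in xQ yQ zQ *; apply: QP.
Qed.


(** The induction principle of the closure. *)
Lemma generatedP (Q : rel D) s t :
    (forall i a b c a' b' c', Q a a' -> Q b b' -> Q c c' ->
      Q (pointwise i a b c) (pointwise i a' b' c')) ->
    (forall f a b, f \in H -> agree f s a -> agree f t b -> Q a b) ->
  forall a b, generated s t a b -> Q a b.
Proof.
move=> Q_op Q_base a b /forallP/(_ [set ab | Q ab.1 ab.2]).
rewrite op_closedP // inE /= => /implyP; apply.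
apply/subsetP=> -[c d]; rewrite !inE => /exists_inP[f fH /andP[]]; exact: Q_base.
Qed.

Lemma generated_base s t f a b :
  f \in H -> agree f s a -> agree f t b -> generated s t a b.
Proof.
move=> fH fs ft; apply/forallP=> S; apply/implyP=> /andP[_ /subsetP]; apply.
by rewrite inE; apply/exists_inP; exists f; rewrite ?fs.
Qed.

Lemma generated_op i s t a b c a' b' c' :
  generated s t a a' -> generated s t b b' -> generated s t c c' ->
  generated s t (pointwise i a b c) (pointwise i a' b' c').
Proof.
move=> /forallP aS /forallP bS /forallP cS; apply/forallP=> S; apply/implyP=> S_closed.
have mem x y : (generated s t x y -> (x, y) \in S) by move=> /forallP/(_ S)/implyP; apply.
case/andP: S_closed => /forallP/(_ i)/forall_inP S_op _.
have /forall_inP/(_ (b, b') _)/forall_inP/(_ (c, c') _) :=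
  S_op (a, a') (mem _ _ (introT forallP aS)).
by apply; apply: mem; apply/forallP.
Qed.

Lemma generated_sym s t a b : generated s t a b -> generated t s b a.
Proof.
apply: (@generatedP (fun a b => generated t s b a)) => [i *|f {}a {}b fH fs ft].
  exact: generated_op.
exact: generated_base ft fs.
Qed.

(** Restrict f to the entries of s and t, at most 2r elements, and extend the
    result to the entries of u. *)
Lemma strategy_extend f s t u a b : f \in H -> agree f s a -> agree f t b ->
  exists g c, [/\ g \in H, agree g s a, agree g t b & agree g u c].
Proof.
move=> fH fs ft.
have card_im (w : X) : #|w @: setT| <= r.
  by apply: leq_trans (leq_imset_card _ _) _; rewrite cardsT card_ord.
pose K := s @: setT :|: t @: setT; pose J := K :|: u @: setT.
have K_some x : x \in K -> f x.
  case/setUP=> /imsetP[k _ ->]; first by rewrite (eqP (forallP fs k)).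
  by rewrite (eqP (forallP ft k)).
pose f' : pfun A B := [ffun x => if x \in K then f x else None].
have dom_f' : dom f' = K.
  apply/setP=> x; rewrite inE ffunE; case: ifP => // xK; exact: K_some.
have f'f : subpfun f' f.
  split; last by move=> x; rewrite dom_f' ffunE => ->.
  by apply/subsetP=> x; rewrite dom_f' => xK; rewrite inE K_some.
have cardK : #|K| <= 2 * r.
  by rewrite (leq_trans (leq_card_setU _ _)) // mul2n -addnn leq_add.
have cardJ : #|J| <= 3 * r.
  by rewrite (leq_trans (leq_card_setU _ _)) // mulSnr leq_add.
have [g [gH dom_g [_ f'g]]] := strategy_forth H_win (subsetUl K (u @: setT)) cardK cardJ
  (strategy_sub H_win fH f'f) dom_f'.
have gf x : x \in K -> g x = f x.
  by move=> xK; rewrite -f'g ?dom_f' // ffunE xK.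
have [k | c guc] := @fin_all_exists _ (fun=> B) (fun k c => g (u k) = Some c).
  have: u k \in dom g by rewrite dom_g !inE imset_f ?orbT.
  by rewrite inE; case: (g (u k)) => // c _; exists c.
exists g, [ffun k => c k]; split=> //; apply/forallP=> k.
- by rewrite gf ?(forallP fs) // !inE imset_f.
- by rewrite gf ?(forallP ft) // !inE imset_f ?orbT.
- by rewrite ffunE guc.
Qed.

(** Path consistency passes to the closure because the relations satisfying it
    are compatible. *)
Lemma generated_path s t u a b : generated s t a b ->
  exists2 c, generated s u a c & generated u t c b.
Proof.
move=> ab; suff /exists_inP[c] : [exists c in generated s u a, generated u t c b].
  by exists c.
apply: (@generatedP (fun a b => [exists c in generated s u a, generated u t c b])) ab.
  move=> i a1 a2 a3 b1 b2 b3 /exists_inP[c1 ac1 cb1] /exists_inP[c2 ac2 cb2].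
  case/exists_inP=> c3 ac3 cb3.
  by apply/exists_inP; exists (pointwise i c1 c2 c3); apply: generated_op.
move=> f {}a {}b fH fs ft; have [g [c [gH gs gt gu]]] := strategy_extend u fH fs ft.
apply/exists_inP; exists c; first exact: (generated_base gH gs gu).
exact: (generated_base gH gu gt).
Qed.

Definition domain s : {set D} := [set a | generated s s a a].

Lemma generated_left s t a b : generated s t a b -> a \in domain s.
Proof.
rewrite inE; apply: (@generatedP (fun a _ => generated s s a a)).
  by move=> i *; apply: generated_op.
by move=> f {}a {}b fH fs _; exact: (generated_base fH fs fs).
Qed.

Lemma generated_walk v i m a b : generated (v i) (v (i + m.+1)) a b ->
  walk generated domain v i m.+1 a b.
Proof.
have stepP k x y : generated (v k) (v k.+1) x y -> step generated domain v k x y.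
  by move=> xy; rewrite /step xy (generated_left xy) (generated_left (generated_sym xy)).
elim: m i a => [|m IHm] i a ab.
  rewrite addn1 in ab; apply/existsP; exists b; rewrite stepP //=.
  by rewrite (generated_left (generated_sym ab)) eqxx.
have [c ac cb] := generated_path (v i.+1) ab.
by apply/existsP; exists c; rewrite stepP //=; apply: IHm; rewrite addSnnS.
Qed.

Lemma strategy_empty : exists2 f, f \in H & forall x, f x = None.
Proof.
have /set0Pn[g gH] := strategy_neq0 H_win.
exists [ffun=> None]; last by move=> x; rewrite ffunE.
by apply: (strategy_sub H_win gH); split=> [|x]; [apply/subsetP=> x|]; rewrite inE ffunE.
Qed.

Lemma domain_ex s : exists a, a \in domain s.
Proof.
have [f fH fN] := strategy_empty.
have [g [gH dom_g _]] : exists g, [/\ g \in H, dom g = s @: setT & subpfun f g].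
  apply: (strategy_forth H_win (sub0set _)) => //; first by rewrite cards0.
    by rewrite (leq_trans (leq_imset_card _ _)) // cardsT card_ord leq_pmull.
  by apply/setP=> x; rewrite !inE fN.
have [k | c gsc] := @fin_all_exists _ (fun=> B) (fun k c => g (s k) = Some c).
  have: s k \in dom g by rewrite dom_g imset_f.
  by rewrite inE; case: (g (s k)) => // c _; exists c.
have gs : agree g s [ffun k => c k] by apply/forallP=> k; rewrite ffunE gsc.
by exists [ffun k => c k]; rewrite inE; exact: (generated_base gH gs gs).
Qed.

(** By path consistency, a pair allowed between v i and v j is realised by a walk
    of any positive length congruent to j - i. *)
Lemma domain_prague : prague pointwise generated domain.
Proof.
split=> [|i s a b c|s a|s t a|n v i j a b n_gt0 pv _ _ ab].
- exact: domain_ex.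
- by rewrite !inE; apply: generated_op.
- by rewrite inE.
- rewrite inE => /(generated_path t)[b ab _].
  by exists b => //; apply: generated_left (generated_sym ab).
(* Chosen so that i + m.+1 = i.+1 * n + j. *)
pose m := n.-1 + (i * n.-1 + j).
have mE : i + m.+1 = j %[mod n].
  suff -> : i + m.+1 = i.+1 * n + j by rewrite modnMDl.
  by rewrite -[in RHS](prednK n_gt0) mulSn mulnS -!addnA addSn addnS addnCA.
exists m.+1 => //; apply: generated_walk.
by rewrite (periodic_modn pv mE).
Qed.

Lemma generated_eq s t a b k k' : generated s t a b -> s k = t k' -> a k = b k'.
Proof.
move=> ab st; apply/eqP; move: a b ab.
apply: (@generatedP (fun a b => a k == b k')).
  by move=> i a b c a' b' c' /eqP ea /eqP eb /eqP ec; rewrite !ffunE ea eb ec.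
move=> f a b _ /forallP/(_ k)/eqP fs /forallP/(_ k')/eqP.
by rewrite -st fs => -[->].
Qed.

Hypothesis arity_le : forall T : symbol V, arity T <= r.

(** A tuple t of a relation is padded to an r-tuple s.  The partial homomorphisms
    of the strategy send t into the relation of B, and invariance of that relation
    extends this to the closure. *)
Lemma domain_sound T (t : (arity T).-tuple A) (s : X) (a : D) :
    t \in SA T -> (forall c, s (widen_ord (arity_le T) c) = tnth t c) ->
    a \in domain s ->
  [tuple a (widen_ord (arity_le T) c) | c < arity T] \in SB T.
Proof.
move=> tT st; pose Q (a _ : D) :=
  [tuple a (widen_ord (arity_le T) c) | c < arity T] \in SB T.
rewrite inE; apply: (@generatedP Q) => [i a1 a2 a3 b1 b2 b3 | f {}a b fH fs _].
  rewrite /Q => a1Q a2Q a3Q.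
  apply: (eq_ind _ (fun u => u \in SB T) (p_SB i a1Q a2Q a3Q)).
  by apply: eq_from_tnth => c; rewrite !tnth_mktuple ffunE.
apply: (strategy_hom H_win fH tT); apply: eq_from_tnth => c.
by rewrite !tnth_map -st (eqP (forallP fs _)) tnth_ord_tuple.
Qed.

(** The value at x is read off the constant tuple at x; [generated_eq] identifies
    it with the matching entry of the solution at any tuple that contains x. *)
Lemma strategy_homomorphic : homomorphic SA SB.
Proof.
have pointwise_xyx i (a b : D) : pointwise i a b a = a.
  by apply/ffunP=> k; rewrite ffunE p_xyx.
have [h hP] := prague_solution pointwise_xyx pointwise_jonsson generated_sym
                 generated_op domain_prague.
exists (fun x => h [ffun=> x] (Ordinal r_gt0)) => T t tT.
case: (pickP (@predT 'I_(arity T))) => [c0 _ | T0]; last first.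
  (* A relation of arity 0 is handled by the empty partial homomorphism. *)
  have [f fH _] := strategy_empty.
  by apply: (strategy_hom H_win fH tT); apply: eq_from_tnth => c; have := T0 c.
pose s : X := [ffun k : 'I_r => nth (tnth t c0) t k].
have st c : s (widen_ord (arity_le T) c) = tnth t c.
  by rewrite ffunE [RHS](tnth_nth (tnth t c0)).
apply: (eq_ind _ (fun u => u \in SB T) (domain_sound tT st (hP s s).2)).
apply: eq_from_tnth => c; rewrite tnth_map tnth_ord_tuple tnth_map.
by apply: generated_eq (hP _ _).1 _; rewrite st ffunE.
Qed.

End StrategyInstance.

(** * Three Jonsson operations *)
Lemma jonsson3_connect (D : finType) (p : 'I_3 -> D -> D -> D -> D) :
  (forall x y, p (inord 0) x x y = x) ->
  (forall x y, p (inord 0) x y y = p (inord 1) x y y) ->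
  (forall x y, p (inord 1) x x y = p (inord 2) x x y) ->
  (forall x y, p (inord 2) x y y = y) ->
  forall a b, connect (jonsson_edge p a b) a b.
Proof.
move=> p0 p01 p12 p2 a b.
have edge i : connect (jonsson_edge p a b) (p i a a b) (p i a b b) /\
              connect (jonsson_edge p a b) (p i a b b) (p i a a b).
  by split; apply: connect1; apply/existsP; exists i; rewrite !eqxx ?orbT.
have := (edge (inord 0)).1; rewrite p0 p01 => /connect_trans; apply.
have := (edge (inord 1)).2; rewrite p12 => /connect_trans; apply.
by have := (edge (inord 2)).1; rewrite p2.
Qed.

Theorem theorem1 (B : finType) (p1 p2 p3 : B -> B -> B -> B)
  (p1_xyx : forall x y, p1 x y x = x)
  (p2_xyx : forall x y, p2 x y x = x)
  (p3_xyx : forall x y, p3 x y x = x)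
  (p1_xxy : forall x y, p1 x x y = x)
  (p12_xyy : forall x y, p1 x y y = p2 x y y)
  (p23_xxy : forall x y, p2 x x y = p3 x x y)
  (p3_xyy : forall x y, p3 x y y = y) :
  algebra_bounded_width (algebra_of_three p1 p2 p3).
Proof.
move=> V SB SB_inv; pose p := tnth [tuple p1; p2; p3].
have pE : (p (inord 0) = p1) * (p (inord 1) = p2) * (p (inord 2) = p3).
  by rewrite /p !(tnth_nth p1) /= !inordK.
have p_xyx i x y : p i x y x = x.
  by rewrite /p; case: i => [[|[|[|]]] lt_i]; rewrite // (tnth_nth p1) /=.
have p_SB i (T : symbol V) x y z : x \in SB T -> y \in SB T -> z \in SB T ->
  [tuple p i (tnth x c) (tnth y c) (tnth z c) | c < arity T] \in SB T.
  move=> xT yT zT; have := @SB_inv T i [tuple x; y; z].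
  have rowE : (tnth [tuple x; y; z] (inord 0) = x) * (tnth [tuple x; y; z] (inord 1) = y)
            * (tnth [tuple x; y; z] (inord 2) = z).
    by rewrite !(tnth_nth x) /= !inordK.
  have rowT k : tnth [tuple x; y; z] k \in SB T.
    by case: k => [[|[|[|]]] lt_k]; rewrite // (tnth_nth x).
  move/(_ rowT) => row_op.
  apply: (eq_ind _ (fun u => u \in SB T) row_op); apply: eq_from_tnth => c.
  by rewrite !tnth_mktuple /= /ternary_op !tnth_mktuple !rowE.
pose r := (\max_(T : symbol V) arity T).+1.
exists (2 * r); exists (3 * r); first by rewrite ltn_pmul2r.
move=> A SA [H H_win].
apply: (strategy_homomorphic p_xyx p_SB (ltn0Sn _) H_win); last first.
  by move=> T; apply/leqW/leq_bigmax.
by apply: jonsson3_connect => x y; apply/ffunP=> k; rewrite !ffunE !pE.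
Qed.
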